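(* Let $\mathcal{X}$ be a real linear space with $\dim\mathcal{X}=n$. A subspace $\mathcal{L}\subset\mathcal{X}\times\mathcal{X}^*$ is a Lagrangian subspace if and only if there exist real $n\times n$ matrices $P,S$ satisfying $$S^TP=P^TS,\qquad \operatorname{rank}\begin{bmatrix} S^T & P^T\end{bmatrix}=n,$$ such that $$\mathcal{L}=\Big\{(x,e)\in\mathcal{X}\times\mathcal{X}^* \;\Big|\; \exists z\in\mathbb{R}^n \text{ s.t. } \begin{bmatrix} x\\ e\end{bmatrix}=\begin{bmatrix} P\\ S\end{bmatrix}z\Big\}.$$
   Context: $\mathcal{X}$ is a finite-dimensional real linear space with dual $\mathcal{X}^*$, and $\langle e\mid x\rangle$ denotes the duality product between $x\in\mathcal{X}$ and $e\in\mathcal{X}^*$. Elements of $\mathcal{X}$ and $\mathcal{X}^*$ are identified with column vectors in $\mathbb{R}^n$ by means of a basis of $\mathcal{X}$ and its dual basis, so that $\langle e\mid x\rangle=e^Tx$. On $\mathcal{X}\times\mathcal{X}^*$ consider the bilinear form $$\langle (x_1,e_1),(x_2,e_2)\rangle_- := \langle e_1\mid x_2\rangle-\langle e_2\mid x_1\rangle.$$ A Lagrangian subspace is a subspace $\mathcal{L}\subset\mathcal{X}\times\mathcal{X}^*$ that equals its own orthogonal companion with respect to $\langle\cdot,\cdot\rangle_-$, i.e. $\mathcal{L}=\{v\in\mathcal{X}\times\mathcal{X}^*\mid \langle v,w\rangle_-=0 \text{ for all } w\in\mathcal{L}\}$. *)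

(* Defs.v *)
From mathcomp Require Import all_boot all_order all_algebra.
From mathcomp Require Import reals.
Set Implicit Arguments.
Unset Strict Implicit.
Unset Printing Implicit Defensive.
Import GRing.Theory.
Local Open Scope ring_scope.

Section Dual.
Variables (R : realType) (X : vectType R).

Definition dual_space : vectType R := 'Hom(X, R^o).

Definition duality (e : dual_space) (x : X) : R := (e : 'Hom(X, R^o)) x.

Definition form_minus (v w : (X * dual_space)%type) : R :=
  duality v.2 w.1 - duality w.2 v.1.

Definition lagrangian (L : {vspace (X * dual_space)%type}) : Prop :=
  forall v, v \in L <-> (forall w, w \in L -> form_minus v w = 0).

Definition dual_basis n (b : n.-tuple X) : n.-tuple dual_space :=
  [tuple (linfun (coord b i : X -> R^o) : dual_space) | i < n].

End Dual.

Definition coord_col (R : realType) (V : vectType R) n (b : n.-tuple V) (v : V)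
  : 'cV[R]_n := \col_i coord b i v.

(* The lemmas below justify identifying X and its dual with column vectors,
   with <e | x> = e^T x. *)
Lemma duality_sum (R : realType) (X : vectType R) n (b : n.-tuple X)
    (k : 'I_n -> R) (x : X) :
  duality (\sum_i k i *: (dual_basis b)`_i) x = \sum_i k i * coord b i x.
Proof.
rewrite /duality sum_lfunE; apply: eq_bigr => i _.
by rewrite -tnth_nth tnth_mktuple scale_lfunE lfunE.
Qed.

Lemma dual_basisP (R : realType) (X : vectType R) n (b : n.-tuple X) :
  basis_of fullv b -> basis_of fullv (dual_basis b).
Proof.
move=> bb; have fb := basis_free bb.
rewrite basisEfree subvf size_tuple.
have -> : \dim {:dual_space X} = n.
  by rewrite -[RHS](size_basis bb) !dimvf; exact: muln1.
rewrite leqnn !andbT; apply/freeP => k k0 j.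
have := duality_sum b k b`_j; rewrite k0 /duality zero_lfunE (bigD1 j) //=.
rewrite coord_free // eqxx mulr1 big1 ?addr0 // => i ij.
by rewrite coord_free // eq_sym (negbTE ij) mulr0.
Qed.

Lemma dualityE (R : realType) (X : vectType R) n (b : n.-tuple X)
    (e : dual_space X) (x : X) : basis_of fullv b ->
  (coord_col (dual_basis b) e)^T *m coord_col b x = (duality e x)%:M.
Proof.
move=> /dual_basisP bd; apply/matrixP => i j; rewrite !ord1 !mxE /= mulr1n.
rewrite [in RHS](coord_basis bd (memvf e)) duality_sum.
by apply: eq_bigr => k _; rewrite !mxE.
Qed.

(* Main.v *)
(** In coordinates, the form is u J w^T for an invertible skew matrix J of size
    2n, and L becomes the row space of a matrix A.  Then L is Lagrangian if and
    only if A spans the kernel of J A^T; since that kernel has dimension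
    2n - rank A, this amounts to A J A^T = 0 together with rank A = n.  The rows
    of a row-free A with n rows are the columns of the stacked matrix [P; S]. *)
Require Import Defs.
From HB Require Import structures.
From mathcomp Require Import all_boot all_order all_algebra.
From mathcomp Require Import reals.
Import GRing.Theory.
Local Open Scope ring_scope.

Section Symplectic.
Context {F : fieldType} {n : nat}.

(** The signs make [row_mx x e] times this matrix equal to [row_mx e (- x)], so that pairing with a
    second row gives [e1 x2 - x1 e2], the form on the product. *)
Definition symplectic_mx : 'M[F]_(n + n) := block_mx 0 (- 1%:M) 1%:M 0.

Lemma mul_row_symplectic m (A B : 'M[F]_(m, n)) :
  row_mx A B *m symplectic_mx = row_mx B (- A).
Proof.
by rewrite mul_row_block !mulmx0 mulmxN !mulmx1 add0r addr0.
Qed.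

Lemma symplectic_unit : symplectic_mx \in unitmx.
Proof.
(* The square of the matrix is [-1], so its inverse is its opposite. *)
apply: (@mulmx1_unit _ _ _ (- symplectic_mx) _).1.
rewrite mulmxN /symplectic_mx mulmx_block !mulmx0 !mul0mx !mulmxN mulNmx !mulmx1.
by rewrite !add0r !addr0 opp_block_mx ?oppr0 ?opprK -scalar_mx_block.
Qed.

Lemma eq_ker_symplecticP m (A : 'M[F]_(m, n + n)) :
  (A :=: kermx (symplectic_mx *m A^T))%MS <->
  A *m symplectic_mx *m A^T = 0 /\ \rank A = n.
Proof.
have rk : \rank (kermx (symplectic_mx *m A^T)) = (n + n - \rank A)%N.
  rewrite mxrank_ker -[\rank A]mxrank_tr; congr (_ - _)%N.
  by rewrite (eqmxMfull A^T) // row_full_unit symplectic_unit.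
split=> [eqA | [A0 rA]].
  split; first by rewrite -mulmxA; apply: sub_kermxP; rewrite -eqA.
  (* As [\rank A <= n + n], the subtraction is exact; the kernel having the rank of [A], this reads
     [\rank A + \rank A = n + n]. *)
  have := subnKC (rank_leq_col A); rewrite -rk -eqA => rA2.
  by apply: double_inj; rewrite -!addnn.
(* An inclusion between spaces of equal rank is an equality, so only [A] inside the kernel is left,
   and that is isotropy. *)
apply/eqmxP; rewrite -(geq_leqif (mxrank_leqif_eq _)).
  by rewrite rk rA addnK.
by apply/sub_kermxP; rewrite mulmxA.
Qed.

Lemma isotropic_row_mxP (P S : 'M[F]_n) :
  row_mx P^T S^T *m symplectic_mx *m (row_mx P^T S^T)^T = 0 <->
  S^T *m P = P^T *m S.
Proof.
rewrite mul_row_symplectic tr_row_mx mul_row_col !trmxK mulNmx.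
by split=> [/subr0_eq | ->] //; rewrite subrr.
Qed.

End Symplectic.

(** After transposition both sides are ranks of sums of the same two row spaces. This reconciles the
    order [S^T, P^T] of the rank condition with the order [x, e] of coordinates. *)
Lemma mxrank_row_mxC (F : fieldType) m n (A B : 'M[F]_(m, n)) :
  \rank (row_mx A B) = \rank (row_mx B A).
Proof.
rewrite -mxrank_tr -[RHS]mxrank_tr !tr_row_mx.
by rewrite -!addsmxE addsmxC.
Qed.

Section Coordinates.
Context {R : realType} {X : vectType R} {n : nat} (b : n.-tuple X).

Definition pair_row (v : X * dual_space X) : 'rV[R]_(n + n) :=
  row_mx (coord_col b v.1)^T (coord_col (dual_basis b) v.2)^T.

Lemma pair_row_is_linear : linear pair_row.
Proof.
move=> a u v; rewrite /pair_row scale_row_mx add_row_mx.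
by congr row_mx; apply/rowP=> i; rewrite !mxE linearP.
Qed.

HB.instance Definition _ :=
  GRing.isLinear.Build R (X * dual_space X)%type 'rV[R]_(n + n) _ pair_row
    pair_row_is_linear.

Hypothesis b_basis : basis_of fullv b.

Lemma pair_row_inj : injective pair_row.
Proof.
move=> [x e] [y f] /eq_row_mx[/trmx_inj/colP eqx /trmx_inj/colP eqe] /=.
have bd := dual_basisP b_basis; congr pair.
  rewrite (coord_basis b_basis (memvf x)) (coord_basis b_basis (memvf y)).
  by apply: eq_bigr => i _; have:= eqx i; rewrite !mxE => ->.
rewrite (coord_basis bd (memvf e)) (coord_basis bd (memvf f)).
by apply: eq_bigr => i _; have:= eqe i; rewrite !mxE => ->.
Qed.

Lemma pair_row_surj (u : 'rV[R]_(n + n)) : exists v, pair_row v = u.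
Proof.
have col_surj (V : vectType R) (c : n.-tuple V) (r : 'rV[R]_n) :
    free c -> (coord_col c (\sum_i r 0 i *: c`_i))^T = r.
  by move=> fc; apply/rowP=> i; rewrite !mxE coord_sum_free.
exists (\sum_i lsubmx u 0 i *: b`_i,
        \sum_i rsubmx u 0 i *: (dual_basis b)`_i).
rewrite /pair_row /= !col_surj ?hsubmxK //; last exact: basis_free b_basis.
exact: basis_free (dual_basisP b_basis).
Qed.

Lemma form_minusE v w :
  pair_row v *m symplectic_mx *m (pair_row w)^T = (form_minus v w)%:M.
Proof.
rewrite mul_row_symplectic tr_row_mx mul_row_col !trmxK mulNmx dualityE //.
rewrite -[X in _ - X]trmxK trmx_mul trmxK dualityE // tr_scalar_mx.
by rewrite -raddfB.
Qed.

(** The rows of [A] are the coordinates of a basis of [L]; injectivity of [pair_row] carries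
    row-space membership back to [L]. *)
Lemma vspace_row_space (L : {vspace (X * dual_space X)%type}) :
  exists A : 'M[R]_(\dim L, n + n), forall v, (v \in L) = (pair_row v <= A)%MS.
Proof.
exists (\matrix_i pair_row (vbasis L)`_i) => v; apply/idP/idP.
  move=> /coord_vbasis->; rewrite linear_sum summx_sub // => i _.
  by rewrite linearZ scalemx_sub // (eq_row_sub i) // rowK.
case/submxP=> z; rewrite mulmx_sum_row.
under eq_bigr => i _ do rewrite rowK -linearZ.
rewrite -linear_sum => /pair_row_inj->.
by apply: memv_suml => i _; rewrite memvZ // vbasis_mem // mem_nth ?size_tuple.
Qed.

Lemma lagrangian_row_space (L : {vspace (X * dual_space X)%type}) m
    (A : 'M[R]_(m, n + n)) : (forall v, (v \in L) = (pair_row v <= A)%MS) ->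
  lagrangian L <-> A *m symplectic_mx *m A^T = 0 /\ \rank A = n.
Proof.
move=> LA; rewrite -eq_ker_symplecticP.
(* The orthogonal companion of [L] is this kernel: by surjectivity of [pair_row], each row of [A]
   comes from a vector of [L], and testing on those rows suffices. *)
have orthP v : (forall w, w \in L -> form_minus v w = 0) <->
    (pair_row v <= kermx (symplectic_mx *m A^T))%MS.
  split=> [v0 | /sub_kermxP v0 w].
    apply/sub_kermxP/rowP=> i; rewrite [RHS]mxE.
    have [w wi] := pair_row_surj (row i A).
    have /v0 vw0 : w \in L by rewrite LA wi row_sub.
    have := form_minusE v w; rewrite vw0 wi tr_row colE mulmxA -colE.
    by move=> /matrixP/(_ 0 0); rewrite [LHS]mxE mulmxA => ->; rewrite mxE mul0rn.
  rewrite LA => /submxP[z wz]; have := form_minusE v w.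
  rewrite wz trmx_mul mulmxA -(mulmxA _ _ A^T) v0 mul0mx.
  by move/matrixP/(_ 0 0); rewrite !mxE.
split=> [lagL | eqA v]; last by rewrite orthP -eqA LA.
apply/eqmxP/andP; split; apply/row_subP=> i.
  by have [v vi] := pair_row_surj (row i A); rewrite -vi -orthP -lagL LA vi row_sub.
have [v vi] := pair_row_surj (row i (kermx (symplectic_mx *m A^T))).
by rewrite -vi -LA lagL orthP vi row_sub.
Qed.

(** Transposition turns the column [z] into the row of coefficients [z^T]. *)
Lemma image_col_mxP (P S : 'M[R]_n) x e :
  (exists z : 'cV[R]_n, col_mx (coord_col b x) (coord_col (dual_basis b) e)
                          = col_mx P S *m z) <->
  (pair_row (x, e) <= row_mx P^T S^T)%MS.
Proof.
rewrite /pair_row -!tr_col_mx; split=> [[z ->] | /submxP[z eqz]].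
  by rewrite trmx_mul submxMl.
by exists z^T; apply: trmx_inj; rewrite trmx_mul trmxK.
Qed.

End Coordinates.

Theorem proposition5p1 (R : realType) (X : vectType R) (n : nat)
    (dimX : \dim {:X} = n) (b : n.-tuple X) (b_basis : basis_of fullv b)
    (L : {vspace (X * dual_space X)%type}) :
  lagrangian L <->
  exists P S : 'M[R]_n,
    [/\ S^T *m P = P^T *m S,
        \rank (row_mx S^T P^T) = n
      & forall (x : X) (e : dual_space X),
          (x, e) \in L <->
          exists z : 'cV[R]_n,
            col_mx (coord_col b x) (coord_col (dual_basis b) e)
              = col_mx P S *m z].
Proof.
split=> [lagL | [P [S [PS rk LP]]]].
  have [A LA] := vspace_row_space b b_basis L.
  have [isoA rA] := (lagrangian_row_space b b_basis L _ A LA).1 lagL.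
  (* [A] has [\dim L] rows, while [row_base A] has [\rank A = n]; generalizing over it lets its row
     count be rewritten to [n]. *)
  have [M eqM] : exists M : 'M[R]_(n, n + n), (M :=: A)%MS.
    by move: (row_base A) (eq_row_base A); rewrite rA => M; exists M.
  have LM v : (v \in L) = (pair_row b v <= M)%MS by rewrite LA eqM.
  (* Since [M] also presents [L], the criterion applies again and gives isotropy of [M] itself. *)
  have [isoM rM] := (lagrangian_row_space b b_basis L _ M LM).1 lagL.
  pose P := (lsubmx M)^T; pose S := (rsubmx M)^T.
  have defM : row_mx P^T S^T = M by rewrite !trmxK hsubmxK.
  exists P, S; split; first by apply/isotropic_row_mxP; rewrite defM.
    by rewrite mxrank_row_mxC defM.
  by move=> x e; rewrite image_col_mxP defM LM.
apply/(lagrangian_row_space b b_basis L _ (row_mx P^T S^T)).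
  by move=> [x e]; apply/idP/idP => [/LP/image_col_mxP | /image_col_mxP/LP].
by split; [apply/isotropic_row_mxP | rewrite mxrank_row_mxC].
Qed.
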